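(* Let $G$ be a very well-covered graph and let $P=\{e_1,\ldots,e_r\}$ be a perfect matching of $G$. Then there is an induced submatching $P'$ of $P$ and $D\in\mathcal{A}_G$ such that $D\subset V(P')$ and $|e\cap D|=1$ for each $e\in P'$. Furthermore, $${\rm v}(I(G))\leq|P'|=|D|\leq{\rm im}(G)\leq{\rm reg}(S/I(G)).$$
   Context: Graphs are finite and simple. Let $G$ be a graph with vertex set $V(G)=\{t_1,\ldots,t_s\}$ and edge set $E(G)$, let $K$ be a field and $S=K[t_1,\ldots,t_s]$ with the standard grading $S=\bigoplus_{d\ge0}S_d$. The edge ideal of $G$ is $I(G)=(t_it_j\mid\{t_i,t_j\}\in E(G))\subset S$. For a graded ideal $I\subset S$, ${\rm Ass}(I)$ is the set of associated primes of $S/I$, and the v-number is ${\rm v}(I)=\min\{d\geq 0\mid\exists\, f\in S_d,\ \mathfrak{p}\in{\rm Ass}(I)\text{ with }(I\colon f)=\mathfrak{p}\}$, where $(I\colon f)=\{g\in S\mid gf\in I\}$. ${\rm reg}(S/I)$ is the Castelnuovo–Mumford regularity: $\max\{j-i\mid b_{i,j}\neq0\}$, where $b_{i,j}$ are the graded Betti numbers of the minimal graded free resolution of $S/I$ over $S$. A set $A\subset V(G)$ is stable if no two of its vertices are joined by an edge. A set $C\subset V(G)$ is a vertex cover if every edge is incident with a vertex of $C$; it is minimal if no proper subset is a vertex cover. $\alpha_0(G)$ is the minimum cardinality of a vertex cover of $G$. $N_G(A)=\bigcup_{a\in A}N_G(a)$, where $N_G(a)$ is the set of vertices adjacent to $a$.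 $\mathcal{A}_G$ is the family of all stable sets $A$ of $G$ such that $N_G(A)$ is a minimal vertex cover of $G$. $G$ is well-covered if all maximal stable sets of $G$ have the same size; $G$ is very well-covered if it is well-covered, has no isolated vertices, and $|V(G)|=2\alpha_0(G)$. A matching is a set of pairwise disjoint edges; a matching $P$ is perfect if $V(G)=\bigcup_{e\in P}e$. For a matching $P$, $V(P)=\bigcup_{e\in P}e$. A matching $P$ is an induced matching of $G$ if the only edges of $G$ contained in $V(P)$ are those of $P$. An induced submatching of $P$ is a subset $P'\subset P$ that is an induced matching of $G$. ${\rm im}(G)$ is the number of edges in a largest induced matching of $G$. *)

(* Defs.v *)
From mathcomp Require Import all_boot all_order all_algebra.
From mathcomp Require Import mpoly.

Set Implicit Arguments.
Unset Strict Implicit.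
Unset Printing Implicit Defensive.

Import Order.TTheory GRing.Theory Num.Theory.
Local Open Scope ring_scope.

(* Finite simple graphs with vertices t_0, ..., t_(s-1). *)

Record sgraph (s : nat) := SGraph {
  adj :> rel 'I_s;
  adj_sym : ssrbool.symmetric adj;
  adj_irrefl : irreflexive adj
}.

Section Graphs.

Variables (s : nat) (G : sgraph s).

Definition edges : {set {set 'I_s}} :=
  [set [set p.1; p.2] | p in [set p : 'I_s * 'I_s | adj G p.1 p.2]].

Definition stable (A : {set 'I_s}) : bool :=
  [forall x in A, forall y in A, ~~ adj G x y].

Definition vertex_cover (C : {set 'I_s}) : bool :=
  [forall e in edges, e :&: C != set0].

Definition minimal_vertex_cover (C : {set 'I_s}) : bool :=
  minset vertex_cover C.

Definition cover_number : nat :=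
  #|[arg min_(C < [set: 'I_s] | vertex_cover C) #|C|]%N|.

Definition neighbors (A : {set 'I_s}) : {set 'I_s} :=
  \bigcup_(a in A) [set x | adj G a x].

Definition calA : {set {set 'I_s}} :=
  [set A | stable A && minimal_vertex_cover (neighbors A)].

Definition well_covered : Prop :=
  forall A B : {set 'I_s}, maxset stable A -> maxset stable B -> #|A| = #|B|.

Definition very_well_covered : Prop :=
  [/\ well_covered,
      forall x, exists y, adj G x y
    & s = (2 * cover_number)%N].

Definition matching (P : {set {set 'I_s}}) : bool :=
  (P \subset edges) && trivIset P.

Definition perfect_matching (P : {set {set 'I_s}}) : bool :=
  matching P && (cover P == [set: 'I_s]).

Definition induced_matching (P : {set {set 'I_s}}) : bool :=
  matching P && ([set e in edges | e \subset cover P] \subset P).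

Definition induced_matching_number : nat :=
  \max_(P : {set {set 'I_s}} | induced_matching P) #|P|.

End Graphs.

(* Ideals of S = K[t_0, ..., t_(s-1)] are given by their membership predicate;
   equality of ideals is pointwise equivalence. *)

Section Ideals.

Variables (K : fieldType) (s : nat).
Local Notation S := {mpoly K[s]}.
Implicit Types I p : S -> Prop.

Definition edge_ideal (G : sgraph s) (f : S) : Prop :=
  exists c : 'I_s -> 'I_s -> S,
    f = \sum_(i < s) \sum_(j < s | adj G i j) c i j * ('X_i * 'X_j).

Definition colon I (f g : S) : Prop := I (g * f).

Definition is_ideal I : Prop :=
  [/\ I 0, forall f g, I f -> I g -> I (f + g) & forall f g, I g -> I (f * g)].

Definition prime_ideal p : Prop :=
  [/\ is_ideal p, ~ p 1 & forall f g, p (f * g) -> p f \/ p g].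

(* The annihilator of the class of f in S/I is (I : f). *)
Definition associated_prime I p : Prop :=
  prime_ideal p /\ exists f : S, forall g, colon I f g <-> p g.

Definition v_witness I (d : nat) : Prop :=
  exists f p, [/\ f \is d.-homog, associated_prime I p
                & forall g, colon I f g <-> p g].

Definition is_v_number I (d : nat) : Prop :=
  v_witness I d /\ forall d', v_witness I d' -> (d <= d')%N.

End Ideals.

Arguments edge_ideal K {s} G f.

(* A sequence of finitely generated graded free modules with maps
     ... -> F_2 -> F_1 -> F_0 -> S/I,    F_i = \bigoplus_a S(- shift i a),
   where elements of F_i are row vectors, F_(i+1) -> F_i is v |-> v *m fdiff i,
   and F_0 -> S/I is v |-> the class of v *m faug.  All shifts are natural
   numbers: S/I lives in degrees >= 0, so a minimal resolution has no
   generator of negative degree. *)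
Record free_seq (K : fieldType) (s : nat) := FreeSeq {
  rk : nat -> nat;
  shift : forall i, 'I_(rk i) -> nat;
  fdiff : forall i, 'M[{mpoly K[s]}]_(rk i.+1, rk i);
  faug : 'cV[{mpoly K[s]}]_(rk 0)
}.

Section Resolutions.

Variables (K : fieldType) (s : nat).
Local Notation S := {mpoly K[s]}.

(* f maps a generator of degree d to f times a generator of degree e, as a
   degree-preserving map. *)
Definition homog_entry (d e : nat) (f : S) : bool :=
  if (e <= d)%N then f \is (d - e).-homog else f == 0.

Definition graded_maps (F : free_seq K s) : Prop :=
  (forall i (a : 'I_(rk F i.+1)) (b : 'I_(rk F i)),
     homog_entry (shift a) (shift b) (fdiff F i a b)) /\
  (forall a : 'I_(rk F 0), homog_entry (shift a) 0 (faug F a 0)).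

(* Row vectors of width 1 are identified with S through their entry. *)
Definition exact_resolution (I : S -> Prop) (F : free_seq K s) : Prop :=
  [/\ forall f : S, exists v : 'rV[S]_(rk F 0), I (f - (v *m faug F) 0 0),
      forall v : 'rV[S]_(rk F 0),
        I ((v *m faug F) 0 0) <-> exists w, v = w *m fdiff F 0
    & forall i (v : 'rV[S]_(rk F i.+1)),
        v *m fdiff F i = 0 <-> exists w, v = w *m fdiff F i.+1].

(* F_(i+1) is mapped into (t_0, ..., t_(s-1)) F_i. *)
Definition minimal_maps (F : free_seq K s) : Prop :=
  forall i (a : 'I_(rk F i.+1)) (b : 'I_(rk F i)), (fdiff F i a b)@_0%MM = 0.

Definition minimal_graded_free_resolution (I : S -> Prop)
    (F : free_seq K s) : Prop :=
  [/\ graded_maps F, exact_resolution I F & minimal_maps F].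

Definition betti (F : free_seq K s) (i j : nat) : nat :=
  #|[set a : 'I_(rk F i) | shift a == j]|.

(* r is the Castelnuovo-Mumford regularity of S/I. *)
Definition is_regularity (I : S -> Prop) (r : int) : Prop :=
  exists F : free_seq K s,
    [/\ minimal_graded_free_resolution I F,
        exists i j, betti F i j <> 0%N /\ r = j%:Z - i%:Z
      & forall i j, betti F i j <> 0%N -> j%:Z - i%:Z <= r].

End Resolutions.

(* Main.v *)
Require Import Defs.
From Stdlib Require Import Classical_Prop.
From mathcomp Require Import all_boot all_order all_algebra.
From mathcomp Require Import mpoly.

Set Implicit Arguments.
Unset Strict Implicit.
Unset Printing Implicit Defensive.

Import Order.TTheory GRing.Theory Num.Theory.
Local Open Scope ring_scope.

(** Combinatorics.  In a very well-covered graph every maximal stable set has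
    half of the vertices, so it contains an endpoint of each edge of the perfect
    matching [P].  Write [mate x] for the vertex matched to [x].  If [z] is
    adjacent to [x] and [w] to [mate x], then [z] and [w] are adjacent: otherwise
    a maximal stable set containing both would miss [x] and [mate x]
    ([mate_neighbors_adj]).  The set [D] is then built greedily: take a vertex
    [x] with a largest neighbourhood, discard [x], its neighbours and the mates
    of all of these, and recurse.  What is discarded has all its edges covered by
    the neighbours of [x], and the maximality of [x] prevents [mate x] from being
    adjacent to anything that remains ([exists_induced_transversal]).  A stable
    set whose neighbours form a vertex cover always belongs to [calA G].

    The v-number.  For [D] in [calA G] the colon of the edge ideal by the product
    of the variables in [D] is the ideal generated by the variables in
    [neighbors G D], which is prime; that product has degree [#|D|].

    The regularity.  Let [e_0, ..., e_(m-1)] be the products of the endpoints of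
    the edges of an induced matching, and let [F] be a graded free resolution of
    [S/I].  It suffices to find a generator of [F_m] of degree at least [2m].
    Classically, the Koszul complex of the [e_j] maps to [F], which maps to the
    Koszul complex of the [e_j] over the quotient of [S] by the variables outside
    the matching, and the composite is homotopic to the projection.  Only the top
    components matter, and they can be reached without Koszul complexes by
    following one connecting homomorphism at a time on each side: a class
    [u_k] in [Tor_k(S/I, S/(e_0, ..., e_(k-1)))] and a class [psi_k] in
    [Ext^k(S/I, S/J_k)], where [J_k] is generated by [e_k, ..., e_(m-1)] and the
    outside variables.  The constant term of [psi_k (u_k)] does not depend on [k]
    and is 1 for [k = 0], where [psi_0] is the augmentation; and [psi_k] lowers
    degrees by [2k] ([syzygy_pairing]).  Since [psi_m] is not zero, some generator
    of [F_m] has degree at least [2m] ([exists_large_shift]).  All the ideals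
    are monomial, so that membership and division reduce to statements on
    exponents. *)

(** * Stable sets and vertex covers *)

Section Covers.

Variables (s : nat) (G : sgraph s).
Implicit Types (A C D : {set 'I_s}) (P : {set {set 'I_s}}).

Lemma stableP A : reflect {in A &, forall x y, ~~ G x y} (stable G A).
Proof.
apply: (iffP forall_inP) => [sA x y xA yA|sA x xA].
  by have /forall_inP := sA x xA; apply.
by apply/forall_inP => y; apply: sA.
Qed.

Lemma edgesP (e : {set 'I_s}) :
  reflect (exists x y, G x y /\ e = [set x; y]) (e \in edges G).
Proof.
apply: (iffP imsetP) => [[[x y]]|[x [y [Gxy ->]]]].
  by rewrite inE /= => Gxy ->; exists x, y.
by exists (x, y); rewrite ?inE.
Qed.

Lemma neighborsP A x : reflect (exists2 a, a \in A & G a x) (x \in neighbors G A).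
Proof.
by apply: (iffP bigcupP) => [[a aA]|[a aA Gax]]; [rewrite inE|]; exists a; rewrite ?inE.
Qed.

Lemma vertex_coverP C :
  reflect (forall x y, G x y -> (x \in C) || (y \in C)) (vertex_cover G C).
Proof.
apply: (iffP forall_inP) => [cC x y Gxy|cC e /edgesP[x [y [Gxy ->]]]].
  have /set0Pn[z] : [set x; y] :&: C != set0 by apply/cC/edgesP; exists x, y.
  by rewrite !inE => /andP[/orP[]/eqP-> ->]; rewrite ?orbT.
by apply/set0Pn; case/orP: (cC _ _ Gxy) => ?; [exists x|exists y];
  rewrite !inE eqxx ?orbT.
Qed.

Lemma vertex_cover_stable C : vertex_cover G C = stable G (~: C).
Proof.
apply/vertex_coverP/stableP => [cC x y|sC x y Gxy].
  by rewrite !inE => xC yC; apply/negP => /cC; rewrite (negPf xC) (negPf yC).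
apply: contraT; rewrite negb_or => /andP[xC yC].
by have := sC x y; rewrite !inE xC yC Gxy => /(_ isT isT).
Qed.

(** Minimality is automatic: an edge from [D] to one of its neighbours has no
    other endpoint in [neighbors G D], because [D] is stable. *)
Lemma calA_of_cover D :
  stable G D -> vertex_cover G (neighbors G D) -> D \in calA G.
Proof.
move=> sD cD; rewrite inE sD; apply/minsetP; split=> // C cC sCD.
apply/eqP; rewrite eqEsubset sCD; apply/subsetP => x /neighborsP[d dD Gdx].
have /orP[dC|//] := vertex_coverP _ cC _ _ Gdx.
have /neighborsP[a aD Gad] := subsetP sCD _ dC.
by have /stableP/(_ _ _ aD dD) := sD; rewrite Gad.
Qed.

(** The complement of a minimum vertex cover is a maximal stable set of size
    [s/2], and all maximal stable sets have the same size. *)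
Lemma maxset_stable_card A :
  very_well_covered G -> maxset (stable G) A -> (2 * #|A|)%N = s.
Proof.
case=> wcG _; rewrite /cover_number; case: arg_minnP => [|C cC minC eq_s].
  by apply/vertex_coverP => x y _; rewrite inE.
have maxC : maxset (stable G) (~: C).
  apply/maxsetP; split=> [|B sB sCB]; first by rewrite -vertex_cover_stable.
  apply/eqP; rewrite eq_sym eqEcard sCB /=.
  rewrite (cardsCs B) (cardsCs (~: C)) setCK leq_sub2l //.
  by apply: minC; rewrite vertex_cover_stable setCK.
move=> maxA; rewrite (wcG _ _ maxA maxC).
suff -> : #|~: C| = #|C| by rewrite -eq_s.
by apply: (@addnI #|C|); rewrite cardsC card_ord addnn -mul2n.
Qed.

End Covers.

(** * Perfect matchings of very well-covered graphs *)

Section Mate.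

Variables (s : nat) (G : sgraph s) (P : {set {set 'I_s}}).
Hypothesis perfP : perfect_matching G P.

Definition mate x := odflt x [pick y in pblock P x :\ x].

Let trivP : trivIset P. Proof. by case/andP: perfP => /andP[]. Qed.

Lemma mate_edge x : (G x (mate x)) /\ ([set x; mate x] \in P).
Proof.
have /andP[/andP[/subsetP sPE _] /eqP covP] := perfP.
have Px : x \in cover P by rewrite covP inE.
have := pblock_mem Px; have := Px; rewrite -mem_pblock /mate.
case: pickP => [y|no_y] /=.
  rewrite !inE => /andP[yx yB] xB BP; have /edgesP[a [b [Gab eB]]] := sPE _ BP.
  have -> : [set x; y] = pblock P x.
    apply/eqP; rewrite eqEcard subUset !sub1set xB yB cards2 eq_sym yx.
    by rewrite eB cards2; case: eqP.
  split=> //; move: xB yB yx; rewrite eB !inE => /orP[]/eqP-> /orP[]/eqP-> //.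
  - by rewrite eqxx.
  - by rewrite adj_sym.
  - by rewrite eqxx.
move=> xB BP; have /edgesP[a [b [Gab eB]]] := sPE _ BP.
have := no_y a; have := no_y b; move: xB; rewrite !inE eB !inE !eqxx /= !orbT !andbT.
case/orP=> /eqP-> /negbFE/eqP e1 /negbFE/eqP e2.
  by rewrite e1 (adj_irrefl G) in Gab.
by rewrite e2 (adj_irrefl G) in Gab.
Qed.

Lemma adj_mate x : G x (mate x). Proof. by case: (mate_edge x). Qed.

Lemma mate_neq x : mate x != x.
Proof. by apply/eqP => e; have := adj_mate x; rewrite e (adj_irrefl G). Qed.

Lemma mate_block x B : B \in P -> x \in B -> B = [set x; mate x].
Proof.
move=> BP xB; have [_ xmP] := mate_edge x.
by rewrite -(def_pblock trivP BP xB) (def_pblock trivP xmP) // !inE eqxx.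
Qed.

Lemma mateK : involutive mate.
Proof.
move=> x; have [_ xmP] := mate_edge x.
have : mate (mate x) \in [set x; mate x].
  by rewrite (mate_block (x := mate x) xmP) !inE eqxx orbT.
by rewrite !inE (negPf (mate_neq _)) orbF => /eqP.
Qed.

(** A stable set is disjoint from its image under [mate]; when it has [s/2]
    elements the two exhaust the vertices. *)
Lemma maximal_stable_mate A x : very_well_covered G ->
  maxset (stable G) A -> (x \in A) || (mate x \in A).
Proof.
move=> vwc maxA; have cardA := maxset_stable_card vwc maxA.
have /stableP sA := maxsetp maxA.
have disA : [disjoint A & mate @: A].
  rewrite -setI_eq0; apply/set0Pn => -[y /setIP[yA /imsetP[z zA zE]]].
  by have := sA _ _ zA yA; rewrite zE adj_mate.
have : A :|: mate @: A == [set: 'I_s].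
  rewrite eqEcard subsetT cardsU disjoint_setI0 // cards0 subn0.
  rewrite card_imset; last exact: inv_inj mateK.
  by rewrite cardsT card_ord addnn -mul2n cardA leqnn.
move/eqP/setP/(_ x); rewrite !inE => /orP[-> //|/imsetP[z zA ->]].
by rewrite mateK zA orbT.
Qed.

(** Otherwise [z] and [w] lie in a common maximal stable set, which can contain
    neither [x] nor [mate x].  The case [z = w] is included: [x] and [mate x] have
    no common neighbour. *)
Lemma mate_neighbors_adj x z w : very_well_covered G ->
  G x z -> G (mate x) w -> G z w.
Proof.
move=> vwc Gxz Gxw; apply: contraT => nGzw.
have sB : stable G [set z; w].
  by apply/stableP => a b; rewrite !inE => /orP[]/eqP-> /orP[]/eqP->;
    rewrite ?(adj_irrefl G) ?nGzw // adj_sym.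
have [A maxA /subsetP sBA] := maxset_exists sB.
have /stableP sA := maxsetp maxA.
have zA : z \in A by rewrite sBA // !inE eqxx.
have wA : w \in A by rewrite sBA // !inE eqxx orbT.
case/orP: (maximal_stable_mate x vwc maxA) => [xA|mA].
  by have := sA _ _ xA zA; rewrite Gxz.
by have := sA _ _ mA wA; rewrite Gxw.
Qed.

(** The induction is on the set [W] of vertices that are left.  The last
    property makes the edges [{d, mate d}] an induced matching, once combined
    with the stability of [D]. *)
Lemma exists_induced_transversal : very_well_covered G ->
  forall W : {set 'I_s}, {in W, forall x, mate x \in W} ->
  exists D : {set 'I_s},
    [/\ D \subset W, stable G D,
       {in W &, forall u v, G u v -> (u \in neighbors G D) || (v \in neighbors G D)}
     & {in D &, forall d d', d != d' -> ~~ G (mate d) d' && ~~ G (mate d) (mate d')}].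
Proof.
move=> vwc W; have [n] := ubnP #|W|; elim: n W => // n IHn W ltWn mW.
have [->|[x0 x0W]] := set_0Vmem W.
  exists set0; split; rewrite ?sub0set //; first by apply/stableP=> x; rewrite inE.
  - by move=> u; rewrite inE.
  - by move=> u; rewrite inE.
pose deg x := #|[set z in W | G x z]|.
have [x xW xmax] : exists2 x, x \in W & forall y, y \in W -> (deg y <= deg x)%N.
  by case: (arg_maxnP deg x0W) => x; exists x.
(* By [mate_neighbors_adj] a vertex [mate d] adjacent to [mate x] would have all
   the neighbours of [x], and [d] in addition. *)
have no_larger d : d \in W -> ~~ G d x -> ~~ G (mate x) (mate d).
  move=> dW nGdx; apply/negP => Gm.
  have := xmax _ (mW _ dW); apply/negP; rewrite -ltnNge; apply: proper_card.
  apply/properP; split.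
    apply/subsetP => z; rewrite !inE => /andP[-> Gxz] /=.
    by rewrite adj_sym; apply: mate_neighbors_adj vwc Gxz Gm.
  by exists d; rewrite !inE dW /= adj_sym ?adj_mate.
pose W' := [set w in W | ~~ G x w && ~~ G x (mate w)].
have W'P w : w \in W' -> [/\ w \in W, ~~ G x w & ~~ G x (mate w)].
  by rewrite inE => /and3P[].
have mW' : {in W', forall w, mate w \in W'}.
  by move=> w /W'P[wW xw xmw]; rewrite inE mW // mateK xw xmw.
have ltW' : (#|W'| < n)%N.
  rewrite -ltnS (leq_trans _ ltWn) // ltnS; apply: proper_card.
  apply/properP; split; first by apply/subsetP => w /W'P[].
  by exists x => //; rewrite inE adj_mate !andbF.
have [D [sDW /stableP sD coverD inducedD]] := IHn W' ltW' mW'.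
have xD d : d \in D -> [/\ d \in W, ~~ G x d & ~~ G x (mate d)].
  by move/(subsetP sDW)/W'P.
have mxD d : d \in D -> ~~ G (mate x) d && ~~ G (mate x) (mate d).
  move=> dD; have [dW xd xmd] := xD d dD.
  rewrite -{1}(mateK d) !no_larger ?mW // adj_sym //.
exists (x |: D); split.
- by apply/subsetP => d; rewrite !inE => /orP[/eqP-> //|/xD[]].
- apply/stableP => a b; rewrite !inE => /orP[/eqP->|aD] /orP[/eqP->|bD].
  + by rewrite (adj_irrefl G).
  + by case: (xD _ bD).
  + by rewrite adj_sym; case: (xD _ aD).
  + exact: sD.
- have xN w : G x w -> w \in neighbors G (x |: D).
    by move=> Gxw; apply/neighborsP; exists x; rewrite ?inE ?eqxx.
  (* A vertex outside [W'] that is not a neighbour of [x] has its mate adjacent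
     to [x], so all its neighbours are adjacent to [x]. *)
  have outN w v : w \in W -> w \notin W' -> G w v ->
      w \notin neighbors G (x |: D) -> v \in neighbors G (x |: D).
    move=> wW; rewrite inE wW /= negb_and !negbK => /orP[/xN-> //|Gxm] Gwv _.
    by apply: xN; rewrite adj_sym; apply: mate_neighbors_adj vwc Gwv _; rewrite adj_sym.
  move=> u v uW vW Guv; apply: contraT; rewrite negb_or => /andP[uN vN].
  have [uW'|nuW'] := boolP (u \in W'); last by move: (vN); rewrite (outN u v).
  have [vW'|nvW'] := boolP (v \in W'); last first.
    by move: (uN); rewrite (outN v u) // adj_sym.
  have sN : neighbors G D \subset neighbors G (x |: D).
    apply/subsetP => z /neighborsP[a aD Gaz]; apply/neighborsP; exists a => //.
    by rewrite !inE aD orbT.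
  by have /orP[/(subsetP sN)|/(subsetP sN)] := coverD _ _ uW' vW' Guv;
    rewrite ?(negPf uN) ?(negPf vN).
- move=> a b; rewrite !inE => /orP[/eqP->|aD] /orP[/eqP->|bD] ab.
  + by rewrite eqxx in ab.
  + exact: mxD.
  + have [_ _ xma] := xD _ aD; have /andP[_ mxma] := mxD _ aD.
    by rewrite adj_sym xma adj_sym.
  + exact: inducedD.
Qed.

Lemma exists_induced_submatching : very_well_covered G ->
  exists (P' : {set {set 'I_s}}) (D : {set 'I_s}),
    [/\ P' \subset P, induced_matching G P' & D \in calA G] /\
    [/\ D \subset cover P', forall e, e \in P' -> #|e :&: D| = 1%N & #|P'| = #|D|].
Proof.
move=> vwc; have mT : {in [set: 'I_s], forall x, mate x \in [set: 'I_s]}.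
  by move=> x; rewrite !inE.
have [D [_ sD coverD inducedD]] := exists_induced_transversal vwc mT.
have stD := stableP _ _ sD.
have pairD d : d \in D -> [set d; mate d] :&: D = [set d].
  move=> dD; apply/setP => z; rewrite !inE; case: eqP => [->|_] /=; first by rewrite dD.
  by case: eqP => [->|//]; apply/negP => mD; have := stD _ _ dD mD; rewrite adj_mate.
pose P' := [set [set d; mate d] | d in D].
have sP'P : P' \subset P by apply/subsetP => _ /imsetP[d _ ->]; case: (mate_edge d).
exists P', D; split; split=> //.
- have /andP[/andP[sPE _] _] := perfP.
  rewrite /induced_matching /matching (subset_trans sP'P sPE) (trivIsetS sP'P trivP) /=.
  apply/subsetP => e; rewrite inE => /andP[/edgesP[u [v [Guv ->]]]].
  rewrite subUset !sub1set.
  move=> /andP[/bigcupP[_ /imsetP[a aD ->] ua] /bigcupP[_ /imsetP[b bD ->] vb]].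
  have [ab|ab] := eqVneq a b; last first.
    have /andP[n1 n2] := inducedD _ _ aD bD ab.
    rewrite eq_sym in ab; have /andP[n3 n4] := inducedD _ _ bD aD ab.
    have n5 := stD _ _ aD bD.
    move: ua vb Guv; rewrite !inE => /orP[]/eqP-> /orP[]/eqP->;
      by rewrite ?(negPf n1) ?(negPf n2) ?(negPf n5) // adj_sym (negPf n3).
  apply/imsetP; exists a => //; move: ua vb Guv; rewrite -ab !inE.
  by move=> /orP[]/eqP-> /orP[]/eqP->; rewrite ?(adj_irrefl G) // setUC.
- apply: calA_of_cover => //; apply/vertex_coverP => x y.
  by apply: coverD; rewrite inE.
- apply/subsetP => d dD; apply/bigcupP; exists [set d; mate d]; first exact: imset_f.
  by rewrite !inE eqxx.
- by move=> _ /imsetP[d dD ->]; rewrite pairD // cards1.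
- rewrite card_in_imset // => a b aD bD eq_ab.
  by apply/set1_inj; rewrite -(pairD a aD) -(pairD b bD) eq_ab.
Qed.

End Mate.

(** * Monomial ideals *)

Section MonomialIdeals.

Variables (K : fieldType) (s : nat).
Local Notation S := {mpoly K[s]}.
Implicit Types (Q : pred 'X_{1..s}) (e m n : 'X_{1..s}) (f g : S).

Definition upward_closed Q := forall n m, Q n -> Q (n + m)%MM.

(** For upward closed [Q], the ideal generated by the monomials with exponent in
    [Q].  Reading membership off the support makes colon ideals and sums of such
    ideals computations with predicates. *)
Definition monomial_ideal Q f : Prop := forall n, f@_n != 0 -> Q n.

Lemma monomial_ideal0 Q : monomial_ideal Q 0.
Proof. by move=> n; rewrite mcoeff0 eqxx. Qed.

Lemma monomial_idealD Q f g :
  monomial_ideal Q f -> monomial_ideal Q g -> monomial_ideal Q (f + g).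
Proof.
move=> Qf Qg n; rewrite mcoeffD; have [->|/Qf //] := eqVneq f@_n 0.
by rewrite add0r => /Qg.
Qed.

Lemma monomial_idealN Q f : monomial_ideal Q f -> monomial_ideal Q (- f).
Proof. by move=> Qf n; rewrite mcoeffN oppr_eq0 => /Qf. Qed.

Lemma monomial_idealB Q f g :
  monomial_ideal Q f -> monomial_ideal Q g -> monomial_ideal Q (f - g).
Proof. by move=> Qf Qg; apply/monomial_idealD/monomial_idealN. Qed.

Lemma monomial_idealM Q f g :
  upward_closed Q -> monomial_ideal Q g -> monomial_ideal Q (f * g).
Proof.
move=> upQ Qg n; rewrite -mcoeff_msupp => /msuppM_le/allpairsP[[a b] /= [_ bg ->]].
by rewrite addmC; apply/upQ/Qg; rewrite -mcoeff_msupp.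
Qed.

Lemma monomial_ideal_sub Q Q' f :
  subpred Q Q' -> monomial_ideal Q f -> monomial_ideal Q' f.
Proof. by move=> sQ Qf n /Qf/sQ. Qed.

Lemma monomial_idealX Q n : Q n -> monomial_ideal Q 'X_[n].
Proof. by move=> Qn m; rewrite mcoeffX; have [<-|_] := eqVneq n m; rewrite ?eqxx. Qed.

Lemma monomial_ideal_colon Q e f :
  monomial_ideal (fun n => Q (n + e)%MM) f <-> monomial_ideal Q ('X_[e] * f).
Proof.
rewrite mulrC; split=> Qf n; last by rewrite -(mcoeffMX _ e) addmC => /Qf; rewrite addmC.
by rewrite -mcoeff_msupp (perm_mem (msuppMX _ _)) => /mapP[m mf ->];
  rewrite addmC; apply: Qf; rewrite -mcoeff_msupp.
Qed.

(** The quotient in the division of [f] by the monomial of exponent [e]. *)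
Definition mquo e f : S := \sum_(n <- msupp f | (e <= n)%MM) f@_n *: 'X_[n - e].

Lemma mcoeff_mquo e f n : (mquo e f)@_n = f@_(n + e).
Proof.
rewrite /mquo [f in RHS]mpolyE !raddf_sum big_mkcond /=; apply: eq_bigr => m _.
case: ifP => [le_em|nle_em]; rewrite !mcoeffZ !mcoeffX.
  by rewrite -(eqm_add2r e (m - e)) submK.
by have [mE|_] := eqVneq m (n + e)%MM; [rewrite mE lem_addl in nle_em|rewrite mulr0].
Qed.

Lemma monomial_ideal_mquo Q Q' e f :
  (forall n, Q' n -> Q n || (e <= n)%MM) ->
  monomial_ideal Q' f -> monomial_ideal Q (f - 'X_[e] * mquo e f).
Proof.
move=> QQ' Q'f n; rewrite mcoeffB; have [le_en|nle_en] := boolP (e <= n)%MM.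
  by rewrite -{2}(submK le_en) addmC mulrC mcoeffMX mcoeff_mquo submK // subrr eqxx.
have -> : ('X_[e] * mquo e f)@_n = 0.
  apply/eqP; rewrite mcoeff_eq0 mulrC (perm_mem (msuppMX _ _)).
  by apply/mapP => -[m _ en]; rewrite en lem_addr in nle_en.
by rewrite subr0 => /Q'f/QQ'; rewrite (negPf nle_en) orbF.
Qed.

(** Row vectors and matrices over [S] that vanish modulo a monomial ideal. *)
Definition mx_in Q p q (A : 'M[S]_(p, q)) := forall i j, monomial_ideal Q (A i j).

Section Matrices.
Variables (Q : pred 'X_{1..s}) (upQ : upward_closed Q).

Lemma mx_in0 p q : mx_in Q (0 : 'M[S]_(p, q)).
Proof. by move=> i j; rewrite mxE; apply: monomial_ideal0. Qed.

Lemma mx_inD p q (A B : 'M[S]_(p, q)) : mx_in Q A -> mx_in Q B -> mx_in Q (A + B).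
Proof. by move=> QA QB i j; rewrite mxE; apply: monomial_idealD. Qed.

Lemma mx_inN p q (A : 'M[S]_(p, q)) : mx_in Q A -> mx_in Q (- A).
Proof. by move=> QA i j; rewrite mxE; apply: monomial_idealN. Qed.

Lemma mx_inB p q (A B : 'M[S]_(p, q)) : mx_in Q A -> mx_in Q B -> mx_in Q (A - B).
Proof. by move=> QA QB; apply/mx_inD/mx_inN. Qed.

Lemma mx_inZ p q f (A : 'M[S]_(p, q)) : mx_in Q A -> mx_in Q (f *: A).
Proof. by move=> QA i j; rewrite mxE; apply: monomial_idealM. Qed.

Lemma mx_inMr p q r (A : 'M[S]_(p, q)) (B : 'M[S]_(q, r)) :
  mx_in Q A -> mx_in Q (A *m B).
Proof.
move=> QA i j; rewrite mxE; elim/big_ind: _ => [|f g|k _].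
- exact: monomial_ideal0.
- exact: monomial_idealD.
- by rewrite mulrC; apply: monomial_idealM.
Qed.

Lemma mx_inMl p q r (A : 'M[S]_(p, q)) (B : 'M[S]_(q, r)) :
  mx_in Q B -> mx_in Q (A *m B).
Proof.
move=> QB i j; rewrite mxE; elim/big_ind: _ => [|f g|k _].
- exact: monomial_ideal0.
- exact: monomial_idealD.
- exact: monomial_idealM.
Qed.

End Matrices.

(** The hypothesis says that the monomial of exponent [e] is a nonzerodivisor
    modulo the ideal. *)
Lemma mx_in_cancel Q e p q (A : 'M[S]_(p, q)) :
  (forall n, Q (n + e)%MM -> Q n) -> mx_in Q ('X_[e] *: A) -> mx_in Q A.
Proof.
move=> Qe QA i j; have := QA i j; rewrite mxE.
by move/(proj2 (monomial_ideal_colon Q e _)); apply: monomial_ideal_sub.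
Qed.

Lemma mx_in_quo Q Q' e p q (A : 'M[S]_(p, q)) :
  (forall n, Q' n -> Q n || (e <= n)%MM) ->
  mx_in Q' A -> mx_in Q (A - 'X_[e] *: map_mx (mquo e) A).
Proof.
by move=> QQ' Q'A i j; rewrite !mxE; apply: monomial_ideal_mquo QQ' (Q'A i j).
Qed.

End MonomialIdeals.

(** * Degrees of syzygies of an ideal containing coprime monomials *)

Section Syzygies.

Variables (K : fieldType) (s : nat) (I : {mpoly K[s]} -> Prop) (F : free_seq K s).
Local Notation S := {mpoly K[s]}.
Hypotheses (idealI : is_ideal I) (gradedF : graded_maps F).
Hypothesis exactF : exact_resolution I F.

(** [e 0, ..., e (m-1)] are the exponents of pairwise coprime monomials of [I],
    which form a regular sequence modulo the monomial ideal of [N].  Together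
    with that ideal they generate an ideal containing [I]. *)
Variables (m : nat) (e : nat -> 'X_{1..s}) (N : pred 'X_{1..s}).
Hypothesis upN : upward_closed N.
Hypothesis N0 : ~~ N 0%MM.
Hypothesis Ne : forall k n, (k < m)%N -> N (n + e k)%MM -> N n.
Hypothesis e_neq0 : forall k, (k < m)%N -> e k != 0%MM.
Hypothesis coprime_e : forall j k n, (j < m)%N -> (k < m)%N -> j != k ->
  (e j <= n + e k)%MM -> (e j <= n)%MM.
Hypothesis Ie : forall k, (k < m)%N -> I 'X_[e k].
Hypothesis I_sub : forall f, I f ->
  monomial_ideal (fun n => N n || [exists j : 'I_m, (e j <= n)%MM]) f.

(** The ideals of [lower k] and of [upper k] are [(e_0, ..., e_(k-1))] and
    [N + (e_k, ..., e_(m-1))].  By coprimality [e_k] is a nonzerodivisor modulo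
    [lower k] and modulo [upper k.+1], and belongs to neither. *)
Definition lower k : pred 'X_{1..s} :=
  fun n => [exists j : 'I_m, (j < k)%N && (e j <= n)%MM].

Definition upper k : pred 'X_{1..s} :=
  fun n => N n || [exists j : 'I_m, (k <= j)%N && (e j <= n)%MM].

Lemma upward_closed_lower k : upward_closed (lower k).
Proof.
move=> n n' /existsP[j /andP[jk en]]; apply/existsP; exists j.
by rewrite jk (lepm_trans en (lem_addr _ _)).
Qed.

Lemma upward_closed_upper k : upward_closed (upper k).
Proof.
move=> n n' /orP[Nn|/existsP[j /andP[jk en]]]; apply/orP; [left|right].
  exact: upN.
by apply/existsP; exists j; rewrite jk (lepm_trans en (lem_addr _ _)).
Qed.

Lemma lower_cancel k n : (k < m)%N -> lower k (n + e k)%MM -> lower k n.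
Proof.
move=> km /existsP[j /andP[jk en]]; apply/existsP; exists j.
by rewrite jk (coprime_e _ _ _ en) ?(ltn_eqF jk).
Qed.

Lemma upper_cancel k n : (k < m)%N -> upper k.+1 (n + e k)%MM -> upper k.+1 n.
Proof.
move=> km /orP[/(Ne km) Nn|/existsP[j /andP[jk en]]]; apply/orP; first by left.
by right; apply/existsP; exists j; rewrite jk (coprime_e _ _ _ en) ?(gtn_eqF jk).
Qed.

Lemma e_le0 k : (k < m)%N -> (e k <= 0)%MM = false.
Proof.
move=> km; apply/negbTE/negP => /mnm_lepP le0; case/eqP: (e_neq0 km).
by apply/mnmP => i; have := le0 i; rewrite mnm0E leqn0 => /eqP.
Qed.

Lemma lower_generator k : (k < m)%N -> ~~ lower k (e k).
Proof.
move=> km; rewrite -[e k]add0m; apply/negP => /(lower_cancel km)/existsP[j].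
by rewrite e_le0 ?andbF.
Qed.

Lemma upper_generator k : (k < m)%N -> ~~ upper k.+1 (e k).
Proof.
move=> km; rewrite -[e k]add0m; apply/negP => /(upper_cancel km).
by rewrite /upper (negPf N0) => /existsP[j]; rewrite e_le0 ?andbF.
Qed.

Lemma lowerS k n : (k < m)%N -> lower k.+1 n = lower k n || (e k <= n)%MM.
Proof.
move=> km; apply/existsP/orP => [[j /andP[]]|[/existsP[j /andP[jk en]]|en]].
- rewrite ltnS leq_eqVlt => /orP[/eqP<-|jk] en; first by right.
  by left; apply/existsP; exists j; rewrite jk.
- by exists j; rewrite en ltnW.
- by exists (Ordinal km); rewrite en leqnn.
Qed.

Lemma upperS k n : upper k n -> upper k.+1 n || (e k <= n)%MM.
Proof.
case/orP=> [Nn|/existsP[j /andP[]]]; first by rewrite /upper Nn.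
rewrite leq_eqVlt => /orP[/eqP->->|kj en]; rewrite ?orbT //.
by apply/orP; left; apply/orP; right; apply/existsP; exists j; rewrite kj.
Qed.

Lemma mx_in_lowerS k p q (A B : 'M[S]_(p, q)) : (k < m)%N ->
  mx_in (lower k) A -> mx_in (lower k.+1) (A + 'X_[e k] *: B).
Proof.
move=> km QA; apply: mx_inD => a b.
  by apply: monomial_ideal_sub (QA a b) => n Qn; rewrite lowerS // Qn.
rewrite mxE; apply/monomial_ideal_colon => n _.
by rewrite lowerS // lem_addl orbT.
Qed.

Lemma fdiffK k (w : 'rV[S]_(rk F k.+2)) : w *m fdiff F k.+1 *m fdiff F k = 0.
Proof. by have [_ _ ex] := exactF; apply/ex; exists w. Qed.

Lemma fdiff_fdiff k : fdiff F k.+1 *m fdiff F k = 0.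
Proof. by apply/row_matrixP => i; rewrite row0 rowE mulmxA fdiffK. Qed.

(** Tor_(i+1)(S/I, S/(e_0, ..., e_(k-1))) = 0 for [i >= k], by induction on [k]:
    this is the long exact sequence of multiplication by [e_k], written with
    representatives. *)
Lemma exact_mod_lower k i (v : 'rV[S]_(rk F i.+1)) : (k <= m)%N -> (k <= i)%N ->
  mx_in (lower k) (v *m fdiff F i) ->
  exists w, mx_in (lower k) (v - w *m fdiff F i.+1).
Proof.
elim: k i v => [|k IHk] i v.
  move=> _ _ v0; have [_ _ ex] := exactF.
  have /ex[w ->] : v *m fdiff F i = 0.
    apply/matrixP => a b; rewrite [RHS]mxE; apply/mpolyP => n; rewrite mcoeff0.
    by apply/eqP; apply/contraT => /(v0 a b)/existsP[].
  by exists w; rewrite subrr; apply: mx_in0.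
case: i v => // i v km ki Qv; set d := fdiff F i.+1 in Qv *.
have upk := @upward_closed_lower k.
pose w := map_mx (mquo (e k)) (v *m d).
have Qw : mx_in (lower k) (v *m d - 'X_[e k] *: w).
  by apply: mx_in_quo Qv => n; rewrite lowerS.
have [|||u Qu] := IHk i w; rewrite ?(ltnW km) //.
  apply: (@mx_in_cancel _ _ (lower k) (e k)) => [n|]; first exact: lower_cancel.
  have -> : 'X_[e k] *: (w *m fdiff F i) = - ((v *m d - 'X_[e k] *: w) *m fdiff F i).
    by rewrite mulmxBl fdiffK sub0r opprK scalemxAl.
  by apply/mx_inN/mx_inMr.
have [|||u' Qu'] := IHk i.+1 (v - 'X_[e k] *: u); rewrite ?(ltnW km) // ?(ltnW ki) //.
  have -> : (v - 'X_[e k] *: u) *m d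
      = (v *m d - 'X_[e k] *: w) + 'X_[e k] *: (w - u *m d).
    by rewrite mulmxBl scalerBr addrA subrK -scalemxAl.
  by apply: mx_inD => //; apply: mx_inZ.
exists u'.
have -> : v - u' *m fdiff F i.+2
    = (v - 'X_[e k] *: u - u' *m fdiff F i.+2) + 'X_[e k] *: u.
  by rewrite addrAC subrK.
exact: mx_in_lowerS.
Qed.

Definition gen_deg k := (\sum_(j < k) mdeg (e j))%N.

(** The first condition says that [e_j] kills the class of [u] in
    [Tor_k(S/I, S/(e_0, ..., e_(k-1)))] for [j >= k]; the case [j = k] provides the
    next [u], and the others are kept for later steps.  The next [psi] is the
    quotient of [fdiff F k *m psi] by [e_k] modulo [upper k.+1]; division by [e_k]
    lowers all degrees by the same amount, so [psi] stays homogeneous. *)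
Lemma syzygy_pairing k : (k <= m)%N ->
  exists (u : 'rV[S]_(rk F k)) (psi : 'cV[S]_(rk F k)),
    [/\ forall j, (k <= j < m)%N ->
           exists w, mx_in (lower k) ('X_[e j] *: u - w *m fdiff F k),
        mx_in (upper k) (fdiff F k *m psi),
        forall a n, (psi a 0)@_n != 0 -> (mdeg n + gen_deg k)%N = shift a
      & ((u *m psi) 0 0)@_0%MM = 1].
Proof.
elim: k => [_|k IHk km].
  have [surj ker _] := exactF; have [u Iu] := surj 1; exists u, (faug F).
  have [I0 ID IM] := idealI.
  split.
  - move=> j /andP[_ jm]; have /ker[w ->] : I (('X_[e j] *: u *m faug F) 0 0).
      rewrite -scalemxAl mxE -[_ * _](subKr 'X_[e j]) -{2}['X_[e j]]mulr1 -mulrBr.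
      by apply: ID; [exact: Ie|rewrite -mulNr; apply: IM].
    by exists w; rewrite subrr; apply: mx_in0.
  - move=> a b; rewrite ord1; have /I_sub : I ((fdiff F 0 *m faug F) a 0).
      have : I (((delta_mx 0 a : 'rV_(rk F 1)) *m fdiff F 0 *m faug F) 0 0).
        by apply/ker; exists (delta_mx 0 a).
      by rewrite -mulmxA -rowE mxE.
    by apply: monomial_ideal_sub => n; rewrite /upper.
  - move=> a n nz; rewrite /gen_deg big_ord0 addn0.
    have [_ /(_ a)] := gradedF; rewrite /homog_entry leq0n subn0 => /dhomogP.
    by apply; rewrite mcoeff_msupp.
  - have <- : (1 : S)@_0%MM = 1 by rewrite mcoeff1 eqxx.
    apply/eqP; rewrite eq_sym -subr_eq0 -mcoeffB; apply/contraT => /(I_sub Iu).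
    by rewrite (negPf N0) => /existsP[j]; rewrite e_le0.
have [u [psi [Hu Hpsi deg_psi pairing]]] := IHk (ltnW km).
have [|u' Hu'] := Hu k; first by rewrite leqnn.
pose psi' := map_mx (mquo (e k)) (fdiff F k *m psi).
have Hpsi' : mx_in (upper k.+1) (fdiff F k *m psi - 'X_[e k] *: psi').
  by apply: mx_in_quo Hpsi => n; apply: upperS.
exists u', psi'; split.
- move=> j /andP[kj jm]; have [|w Hw] := Hu j; first by rewrite ltnW.
  have [|||w' Hw'] := @exact_mod_lower k k ('X_[e j] *: u' - 'X_[e k] *: w);
    rewrite ?(ltnW km) //.
    have -> : ('X_[e j] *: u' - 'X_[e k] *: w) *m fdiff F k
       = 'X_[e k] *: ('X_[e j] *: u - w *m fdiff F k)
         - 'X_[e j] *: ('X_[e k] *: u - u' *m fdiff F k).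
      rewrite mulmxBl -!scalemxAl !scalerBr !scalerA [_ * 'X_[e j]]mulrC.
      by rewrite opprB [RHS]addrC addrA subrK.
    by apply: mx_inB; apply: mx_inZ => //; apply: upward_closed_lower.
  exists w'; have -> : 'X_[e j] *: u' - w' *m fdiff F k.+1
      = ('X_[e j] *: u' - 'X_[e k] *: w - w' *m fdiff F k.+1) + 'X_[e k] *: w.
    by rewrite addrAC subrK.
  exact: mx_in_lowerS.
- apply: (@mx_in_cancel _ _ _ (e k)) => [n|]; first exact: upper_cancel.
  have -> : 'X_[e k] *: (fdiff F k.+1 *m psi')
      = - (fdiff F k.+1 *m (fdiff F k *m psi - 'X_[e k] *: psi')).
    by rewrite mulmxBr mulmxA fdiff_fdiff mul0mx sub0r opprK scalemxAr.
  by apply/mx_inN/mx_inMl => //; apply: upward_closed_upper.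
- move=> a n; rewrite mxE mcoeff_mquo mxE => nz.
  have [b] : exists b, (fdiff F k a b * psi b 0)@_(n + e k) != 0.
    apply/existsP; apply: contraNT nz; rewrite negb_exists => /forallP nz.
    by rewrite raddf_sum /= big1 ?eqxx // => b _; apply/eqP; rewrite -[_ == _]negbK nz.
  rewrite -mcoeff_msupp => /msuppM_le/allpairsP[[n1 n2] /= [n1d n2psi nE]].
  rewrite /gen_deg big_ord_recr /= addnCA -mdegD nE mdegD addnC -addnA.
  rewrite -/(gen_deg k) (deg_psi b) -?mcoeff_msupp //.
  have [/(_ k a b) + _] := gradedF; rewrite /homog_entry; case: leqP => [le_ba|_ /eqP d0].
    by move/dhomogP/(_ _ n1d) => /= ->; rewrite subnK.
  by rewrite d0 msupp0 in n1d.
- (* [e_k (u psi - u' psi')] is a sum of an element of [lower k] and one of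
     [upper k.+1]; neither involves the monomial [e_k], whose coefficient is the
     constant term of [u psi - u' psi']. *)
  have Qu : mx_in (lower k) ('X_[e k] *: (u *m psi) - u' *m fdiff F k *m psi).
    by rewrite scalemxAl -mulmxBl; apply: mx_inMr => //; apply: upward_closed_lower.
  have Qpsi : mx_in (upper k.+1) (u' *m fdiff F k *m psi - 'X_[e k] *: (u' *m psi')).
    by rewrite scalemxAr -mulmxA -mulmxBr; apply: mx_inMl => //;
      apply: upward_closed_upper.
  have entB (A B : 'M[S]_1) : (A - B) 0 0 = A 0 0 - B 0 0 by rewrite !mxE.
  have entZ f (A : 'M[S]_1) : (f *: A) 0 0 = f * A 0 0 by rewrite mxE.
  apply/eqP; rewrite -pairing eq_sym -subr_eq0 -mcoeffB -(mcoeffMX _ (e k)) addm0 mulrC.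
  rewrite mulrBr -(subrKA ((u' *m fdiff F k *m psi) 0 0)) mcoeffD.
  have -> : ('X_[e k] * (u *m psi) 0 0 - (u' *m fdiff F k *m psi) 0 0)@_(e k) = 0.
    apply/eqP/contraT => nz; have := Qu 0 0 (e k).
    by rewrite entB entZ (negPf (lower_generator km)) => /(_ nz).
  rewrite add0r; apply/contraT => nz; have := Qpsi 0 0 (e k).
  by rewrite entB entZ (negPf (upper_generator km)) => /(_ nz).
Qed.

(** A nonzero entry of the last [psi], at a generator [a], has degree
    [shift a - gen_deg m]. *)
Lemma exists_large_shift : exists a : 'I_(rk F m), (gen_deg m <= shift a)%N.
Proof.
have [u [psi [_ _ deg_psi pairing]]] := syzygy_pairing (leqnn m).
have [a] : exists a, psi a 0 != 0.
  apply/existsP; apply: contraTT (oner_neq0 K); rewrite negb_exists => /forallP psi0.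
  rewrite negbK -pairing mxE big1 ?mcoeff0 // => a _.
  by have := psi0 a; rewrite negbK => /eqP->; rewrite mulr0.
rewrite -msupp_eq0; case: (msupp _) (mcoeff_msupp (psi a 0)) => // n r suppE _.
by exists a; rewrite -(deg_psi a n) ?leq_addl // -suppE inE eqxx.
Qed.

End Syzygies.

(** * Prime monomial ideals *)

Section MonomialPrime.

Variables (K : fieldType) (s : nat) (Q : pred 'X_{1..s}).
Local Notation S := {mpoly K[s]}.
Hypothesis upQ : upward_closed Q.

Lemma monomial_ideal_is_ideal : is_ideal (monomial_ideal Q : S -> Prop).
Proof.
split; [exact: monomial_ideal0|exact: monomial_idealD|].
by move=> f g; apply: monomial_idealM.
Qed.

Lemma monomial_ideal_normal_form (f : S) :
  exists f1 : S, monomial_ideal Q (f - f1) /\ monomial_ideal (predC Q) f1.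
Proof.
exists (\sum_(n <- msupp f | ~~ Q n) f@_n *: 'X_[n]); split.
  rewrite [f in f - _]mpolyE (bigID Q) /= addrK.
  elim/big_ind: _ => [|g h|n Qn]; [exact: monomial_ideal0|exact: monomial_idealD|].
  by rewrite -mul_mpolyC; apply/monomial_idealM/monomial_idealX.
elim/big_ind: _ => [|g h|n Qn]; [exact: monomial_ideal0|exact: monomial_idealD|].
by move=> m; rewrite mcoeffZ mcoeffX; have [<-//|_] := eqVneq n m; rewrite mulr0 eqxx.
Qed.

(** Modulo the ideal, [f] and [g] can be replaced by polynomials supported
    outside [Q]; so is the product of these, which can then lie in the ideal only
    if it vanishes. *)
Lemma monomial_ideal_prime :
  ~~ Q 0%MM -> (forall n m, Q (n + m)%MM -> Q n || Q m) ->
  prime_ideal (monomial_ideal Q : S -> Prop).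
Proof.
move=> Q0 QD; split; first exact: monomial_ideal_is_ideal.
  by move=> /(_ 0%MM); rewrite mcoeff1 eqxx oner_eq0 => /(_ isT); apply/negP.
move=> f g Qfg; have [f1 [Qf nQf1]] := monomial_ideal_normal_form f.
have [g1 [Qg nQg1]] := monomial_ideal_normal_form g.
have Qf1g1 : monomial_ideal Q (f1 * g1).
  have -> : f1 * g1 = f * g - f * (g - g1) - (f - f1) * g1.
    by rewrite mulrBr mulrBl !subKr.
  apply: monomial_idealB; first by apply: monomial_idealB => //; apply: monomial_idealM.
  by rewrite mulrC; apply: monomial_idealM.
have /eqP : f1 * g1 = 0.
  apply/mpolyP => n; rewrite mcoeff0; apply/eqP/contraT => nz; have := Qf1g1 n nz.
  move: nz; rewrite -mcoeff_msupp => /msuppM_le/allpairsP[[a b] /= [af bg ->]].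
  have := nQf1 a; have := nQg1 b; rewrite -!mcoeff_msupp.
  move=> /(_ bg)/negPf Qb /(_ af)/negPf Qa.
  by move/QD; rewrite Qa Qb.
by rewrite mulf_eq0 => /orP[]/eqP z; [left; move: Qf|right; move: Qg]; rewrite z subr0.
Qed.

End MonomialPrime.

(** * Edge ideals: v-number and regularity *)

Section EdgeIdeal.

Variables (K : fieldType) (s : nat) (G : sgraph s).
Local Notation S := {mpoly K[s]}.

Definition edge_monomial : pred 'X_{1..s} := fun n =>
  [exists p : 'I_s * 'I_s, [&& G p.1 p.2, (0 < n p.1)%N & (0 < n p.2)%N]].

Definition meets (A : {set 'I_s}) : pred 'X_{1..s} := fun n =>
  [exists i in A, (0 < n i)%N].

Lemma upward_closed_edge_monomial : upward_closed edge_monomial.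
Proof.
move=> n m /existsP[p /and3P[Gp n1 n2]]; apply/existsP; exists p.
by rewrite Gp !mnmDE !addn_gt0 n1 n2.
Qed.

Lemma edge_ideal_is_ideal : is_ideal (edge_ideal K G).
Proof.
split.
- exists (fun _ _ => 0); rewrite big1 // => i _.
  by rewrite big1 // => j _; rewrite mul0r.
- move=> _ _ [c ->] [c' ->]; exists (fun i j => c i j + c' i j).
  rewrite -big_split; apply: eq_bigr => i _; rewrite -big_split.
  by apply: eq_bigr => j _; rewrite mulrDl.
- move=> f _ [c ->]; exists (fun i j => f * c i j).
  rewrite mulr_sumr; apply: eq_bigr => i _.
  by rewrite mulr_sumr; apply: eq_bigr => j _; rewrite mulrA.
Qed.

Lemma edge_ideal_generator i j : G i j -> edge_ideal K G ('X_i * 'X_j).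
Proof.
move=> Gij; exists (fun a b => ((a == i) && (b == j))%:R).
rewrite (bigD1 i) //= (bigD1 j) //= !eqxx mul1r !big1 ?addr0 //.
  by move=> a /negPf ai; rewrite big1 // => b _; rewrite ai mul0r.
by move=> b /andP[_ /negPf bj]; rewrite bj mul0r.
Qed.

Lemma edge_idealP f : edge_ideal K G f <-> monomial_ideal edge_monomial f.
Proof.
have [I0 ID IM] := edge_ideal_is_ideal.
split=> [[c ->]|Qf].
  apply: (big_ind (monomial_ideal edge_monomial)) => [|g h|i _];
    [exact: monomial_ideal0|exact: monomial_idealD|].
  apply: (big_ind (monomial_ideal edge_monomial)) => [|g h|j Gij];
    [exact: monomial_ideal0|exact: monomial_idealD|].
  apply: monomial_idealM upward_closed_edge_monomial _.
  rewrite -mpolyXD; apply: monomial_idealX; apply/existsP; exists (i, j).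
  by rewrite /= Gij !mnmDE !mnm1E !eqxx addn1.
rewrite [f]mpolyE big_seq; apply: (big_ind (edge_ideal K G)) => // n.
rewrite mcoeff_msupp => /Qf/existsP[[i j] /= /and3P[Gij ni nj]].
have le_n : (U_(i) + U_(j) <= n)%MM.
  apply/mnm_lepP => k; rewrite mnmDE !mnm1E.
  have [<-|_] := eqVneq i k; last by case: eqP => [<-|].
  have [ji|_ //] := eqVneq j i; by rewrite ji (adj_irrefl G) in Gij.
rewrite -mul_mpolyC -(submK le_n) !mpolyXD mulrA.
exact/IM/edge_ideal_generator.
Qed.

(** Every edge has an endpoint in [neighbors G D], and that endpoint is not in
    [D], so it must come from [n]; conversely a variable in [neighbors G D] forms
    an edge with a variable of [D]. *)
Lemma edge_monomial_add_calA D n : D \in calA G ->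
  edge_monomial (n + mesym1 D)%MM = meets (neighbors G D) n.
Proof.
rewrite inE => /andP[/stableP sD /minsetp/vertex_coverP cD].
have meets_n x : (0 < (n + mesym1 D)%MM x)%N -> x \in neighbors G D ->
    meets (neighbors G D) n.
  rewrite mnmDE addn_gt0 mnmE lt0b => /orP[nx|xD] xN.
    by apply/existsP; exists x; rewrite xN.
  by have /neighborsP[a aD Gax] := xN; have := sD _ _ aD xD; rewrite Gax.
apply/existsP/existsP => [[[i j] /= /and3P[Gij ni nj]]|].
  by apply/existsP; case/orP: (cD _ _ Gij); apply: meets_n.
case=> j /andP[/neighborsP[i iD Gij] nj]; exists (i, j).
by rewrite /= Gij !mnmDE !addn_gt0 !mnmE iD nj orbT.
Qed.

Lemma edge_ideal_v_witness D : D \in calA G -> v_witness (edge_ideal K G) #|D|.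
Proof.
move=> DA; exists 'X_[mesym1 D], (monomial_ideal (meets (neighbors G D))).
have colonE g : colon (edge_ideal K G) 'X_[mesym1 D] g
                <-> monomial_ideal (meets (neighbors G D)) g.
  rewrite /colon edge_idealP mulrC -monomial_ideal_colon.
  by split; apply: monomial_ideal_sub => n; rewrite edge_monomial_add_calA.
split=> //; first by rewrite dhomogX; apply/eqP/mdeg_mesym1.
split; last by exists 'X_[mesym1 D].
apply: monomial_ideal_prime.
- move=> n m /existsP[i /andP[iN ni]]; apply/existsP; exists i.
  by rewrite iN mnmDE addn_gt0 ni.
- by apply/existsP => -[i]; rewrite mnm0E andbF.
- move=> n m /existsP[i /andP[iN]]; rewrite mnmDE addn_gt0.
  by move=> /orP[ni|mi]; apply/orP; [left|right]; apply/existsP; exists i; rewrite iN.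
Qed.

(** [exists_large_shift] for the monomials of the edges of [M], with [N] the
    monomials divisible by a variable outside the matching.  As [M] is induced,
    an edge of [G] belongs to [M] or has a vertex outside [cover M]. *)
Lemma induced_matching_le_shift M F : induced_matching G M ->
  graded_maps F -> exact_resolution (edge_ideal K G) F ->
  exists a : 'I_(rk F #|M|), (2 * #|M| <= shift a)%N.
Proof.
move=> /andP[/andP[/subsetP sME trivM] /subsetP indM] gradedF exactF.
pose B k := nth set0 (enum M) k.
have BM k : (k < #|M|)%N -> B k \in M by move=> km; rewrite -mem_enum mem_nth -?cardE.
have B_lift A : A \in M -> exists j : 'I_#|M|, B j = A.
  by move=> AM; exists (enum_rank_in AM A); rewrite /B -enum_val_nth enum_rankK_in.
have disB j k x : (j < #|M|)%N -> (k < #|M|)%N -> j != k -> x \in B j -> x \notin B k.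
  move=> jm km njk xBj; apply: contra njk => xBk.
  by rewrite -(nth_uniq set0 _ _ (enum_uniq M)) -?cardE // -/(B j) -/(B k)
     -(def_pblock trivM (BM j jm) xBj) -(def_pblock trivM (BM k km) xBk).
pose N : pred 'X_{1..s} := meets (~: cover M).
have mesym1_disj (A C : {set 'I_s}) x (n : 'X_{1..s}) : (x \in A -> x \notin C) ->
    (mesym1 A x <= (n + mesym1 C)%MM x)%N -> (mesym1 A x <= n x)%N.
  by rewrite mnmDE !mnmE; case: (x \in A) => // /(_ isT)/negPf->; rewrite addn0.
have gen_degM : gen_deg (fun k => mesym1 (B k)) #|M| = (2 * #|M|)%N.
  rewrite /gen_deg (eq_bigr (fun=> 2%N)) => [|j _].
    by rewrite sum_nat_const card_ord mulnC.
  have /sME/edgesP[x [y [Gxy BE]]] := BM _ (ltn_ord j).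
  rewrite BE mdeg_mesym1 cards2; case: eqP => // xy.
  by rewrite xy (adj_irrefl G) in Gxy.
rewrite -gen_degM; apply: (@exists_large_shift K s (edge_ideal K G) F
    edge_ideal_is_ideal gradedF exactF #|M| (fun k => mesym1 (B k)) N).
- move=> n m /existsP[i /andP[iN ni]]; apply/existsP; exists i.
  by rewrite iN mnmDE addn_gt0 ni.
- by apply/existsP => -[i]; rewrite mnm0E andbF.
- move=> k n km /existsP[x /andP[xN nx]]; apply/existsP; exists x; rewrite xN.
  move: nx; rewrite mnmDE mnmE (_ : x \in B k = false) ?addn0 //.
  by apply: contraTF xN; rewrite inE negbK => xB;
    apply/bigcupP; exists (B k); rewrite ?BM.
- move=> k km; have /sME/edgesP[x [y [_ BE]]] := BM _ km.
  by apply/eqP => /mnmP/(_ x); rewrite mnmE mnm0E BE !inE eqxx.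
- move=> j k n jm km njk /mnm_lepP le_jk; apply/mnm_lepP => x.
  by apply: mesym1_disj (le_jk x) => xB; apply: disB xB.
- move=> k km; apply/edge_idealP/monomial_idealX.
  have /sME/edgesP[x [y [Gxy ->]]] := BM _ km.
  by apply/existsP; exists (x, y); rewrite /= Gxy !mnmE !inE !eqxx orbT.
- move=> f /edge_idealP; apply: monomial_ideal_sub => n.
  case/existsP=> -[x y] /= /and3P[Gxy nx ny].
  have [xM|xM] := boolP (x \in cover M); last first.
    by apply/orP; left; apply/existsP; exists x; rewrite inE xM.
  have [yM|yM] := boolP (y \in cover M); last first.
    by apply/orP; left; apply/existsP; exists y; rewrite inE yM.
  have /B_lift[j Bj] : [set x; y] \in M.
    apply: indM; rewrite inE subUset !sub1set xM yM !andbT.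
    by apply/edgesP; exists x, y.
  apply/orP; right; apply/existsP; exists j; rewrite Bj; apply/mnm_lepP => z.
  by rewrite mnmE !inE; have [->|_] := eqVneq z x => //; case: eqP => [->|].
Qed.

Lemma induced_matching_number_le_regularity r :
  is_regularity (edge_ideal K G) r -> (induced_matching_number G)%:Z <= r.
Proof.
case=> F [[gradedF exactF _] _ le_r].
have le_indr M : induced_matching G M -> #|M|%:Z <= r.
  move=> indM; have [a le_a] := induced_matching_le_shift indM gradedF exactF.
  have : betti F #|M| (shift a) <> 0%N.
    by apply/eqP; rewrite -lt0n; apply/card_gt0P; exists a; rewrite inE.
  move/le_r; apply: le_trans; rewrite lerBrDr -PoszD lez_nat addnn -mul2n //.
have ind0 : induced_matching G set0.
  rewrite /induced_matching /matching sub0set /=; apply/andP; split.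
    by apply/trivIsetP => A; rewrite inE.
  apply/subsetP => e; rewrite inE => /andP[/edgesP[x [y [_ ->]]]].
  by move=> /subsetP/(_ x); rewrite /cover big_set0 !inE eqxx => /(_ isT).
(* The empty matching makes [r] a natural number, so that the maximum can be
   compared with it in [nat]. *)
have := le_indr _ ind0; rewrite cards0; case: r {le_r} le_indr => // n le_indn _.
rewrite lez_nat; apply/bigmax_leqP => M indM.
by rewrite -lez_nat le_indn.
Qed.

End EdgeIdeal.

Lemma exists_minimum (W : nat -> Prop) n : W n ->
  exists2 v, W v /\ (forall k, W k -> (v <= k)%N) & (v <= n)%N.
Proof.
elim/ltn_ind: n => n IHn Wn.
have [[k [ltkn Wk]]|no_k] := classic (exists k, (k < n)%N /\ W k).
  have [v Wv le_vk] := IHn k ltkn Wk; exists v => //.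
  by rewrite (leq_trans le_vk) // ltnW.
exists n => //; split=> // k Wk; rewrite leqNgt; apply/negP => ltkn.
by apply: no_k; exists k.
Qed.

Theorem theorem4p3 (K : fieldType) (s : nat) (G : sgraph s)
    (P : {set {set 'I_s}}) :
  very_well_covered G -> perfect_matching G P ->
  exists (P' : {set {set 'I_s}}) (D : {set 'I_s}),
    [/\ P' \subset P, induced_matching G P' & D \in calA G] /\
    [/\ D \subset cover P' & forall e, e \in P' -> #|e :&: D| = 1%N] /\
    [/\ exists2 v, is_v_number (edge_ideal K G) v & (v <= #|P'|)%N,
        #|P'| = #|D|,
        (#|D| <= induced_matching_number G)%N
      & forall r, is_regularity (edge_ideal K G) r ->
          (induced_matching_number G)%:Z <= r].
Proof.
move=> vwc perfP.
have [P' [D [[sP'P indP' DA] [sDP' oneD cardP']]]] :=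
  exists_induced_submatching perfP vwc.
exists P', D; split=> //; split=> //; split=> //.
- by rewrite cardP'; apply/exists_minimum/edge_ideal_v_witness.
- by rewrite -cardP' /induced_matching_number (bigD1 P') //= leq_maxl.
- exact: induced_matching_number_le_regularity.
Qed.
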